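(* Let $N\geq 2$ be an integer and let $\Bbbk$ be a field of characteristic different from $2$. Let $\mathcal{O}_N=\Bbbk[[T_1,\dots,T_N]]$ and let $\beta:\mathbb{N}\to\mathbb{N}$ be the Artin function of the polynomial $$P(X,Y,Z):=X^2-ZY^2\in\mathcal{O}_N[X,Y,Z].$$ Then $\beta$ is bounded below by a polynomial function of degree $2$ with positive leading coefficient, i.e. there is a polynomial $q\in\mathbb{R}[t]$ of degree $2$ with positive leading coefficient such that $\beta(i)\geq q(i)$ for all $i\in\mathbb{N}$.
   Context: $\mathcal{O}_N=\Bbbk[[T_1,\dots,T_N]]$ is the ring of formal power series in $N$ variables over the field $\Bbbk$, with maximal ideal $\mathfrak{m}_N=(T_1,\dots,T_N)$. Artin function. Let $I$ be an ideal of $\mathcal{O}_N[X_1,\dots,X_n]$ generated by $f_1,\dots,f_r$. By Artin's strong approximation theorem there exists a function $\beta:\mathbb{N}\to\mathbb{N}$ such that for every $i\in\mathbb{N}$ and every $x\in\mathcal{O}_N^n$ with $f_l(x)\in\mathfrak{m}_N^{\beta(i)+1}$ for all $l$, there exists $\overline{x}\in\mathcal{O}_N^n$ with $f_l(\overline{x})=0$ for all $l$ and $\overline{x}-x\in\mathfrak{m}_N^{i+1}\mathcal{O}_N^n$ (coordinatewise). The Artin function of $I$ is the smallest (pointwise) function $\beta:\mathbb{N}\to\mathbb{N}$ with this property. The Artin function of a polynomial is the Artin function of the principal ideal it generates. *)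

(* Defs.v *)
From HB Require Import structures.
From mathcomp Require Import all_boot all_order all_algebra.
From mathcomp Require Import boolp classical_sets reals.
From mathcomp Require Import mpoly.

Set Implicit Arguments.
Unset Strict Implicit.
Unset Printing Implicit Defensive.

Import GRing.Theory.

Local Open Scope ring_scope.

(* The coefficient families are wrapped in a record because the bare function
   type ['X_{1..N} -> K] may receive a pointwise ring structure. *)
Record mfps (N : nat) (K : Type) := MFps { fcoef : 'X_{1..N} -> K }.

Notation "{ 'fps' K [ N ] }" := (mfps N K)
  (at level 0, K at level 2, N at level 2, format "{ 'fps'  K [ N ] }")
  : type_scope.

HB.instance Definition _ (N : nat) (K : Type) :=
  gen_eqMixin {fps K[N]}.
HB.instance Definition _ (N : nat) (K : Type) :=
  gen_choiceMixin {fps K[N]}.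

Section FpsRing.
Variables (N : nat) (K : comNzRingType).
Implicit Types (f g h : {fps K[N]}) (m : 'X_{1..N}).

Lemma fpsP f g : (forall m, fcoef f m = fcoef g m) -> f = g.
Proof. by case: f g => [f] [g] /= fg; congr MFps; apply/funext. Qed.

Definition fps_zero : {fps K[N]} := MFps (fun=> 0).
Definition fps_one : {fps K[N]} := MFps (fun m => (m == 0%MM)%:R).
Definition fps_opp f : {fps K[N]} := MFps (fun m => - fcoef f m).
Definition fps_add f g : {fps K[N]} :=
  MFps (fun m => fcoef f m + fcoef g m).

(* Cauchy product.  The bound on the degrees only makes the index type finite:
   [m = k.1 + k.2] already forces both degrees to be at most [mdeg m]. *)
Definition fps_mul f g : {fps K[N]} :=
  MFps (fun m =>
    \sum_(k : 'X_{1..N < (mdeg m).+1, (mdeg m).+1} | m == (k.1 + k.2)%MM)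
       fcoef f k.1 * fcoef g k.2).

Lemma fps_addA : associative fps_add.
Proof. by move=> f g h; apply: fpsP => m /=; rewrite addrA. Qed.
Lemma fps_addC : commutative fps_add.
Proof. by move=> f g; apply: fpsP => m /=; rewrite addrC. Qed.
Lemma fps_add0 : left_id fps_zero fps_add.
Proof. by move=> f; apply: fpsP => m /=; rewrite add0r. Qed.
Lemma fps_addN : left_inverse fps_zero fps_opp fps_add.
Proof. by move=> f; apply: fpsP => m /=; rewrite addNr. Qed.

HB.instance Definition _ := GRing.isZmodule.Build {fps K[N]}
  fps_addA fps_addC fps_add0 fps_addN.

(* Truncation to total degree < d; it transports the ring axioms from
   polynomials to power series. *)
Definition fps_trunc (d : nat) f : {mpoly K[N]} :=
  \sum_(m : 'X_{1..N < d}) fcoef f m *: 'X_[m].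

Lemma mcoeff_trunc d f m : (mdeg m < d)%N -> (fps_trunc d f)@_m = fcoef f m.
Proof. exact: mcoeff_mpoly. Qed.

Lemma mcoeffM_eq (p q p' q' : {mpoly K[N]}) m :
  (forall k, (mdeg k <= mdeg m)%N -> p@_k = p'@_k) ->
  (forall k, (mdeg k <= mdeg m)%N -> q@_k = q'@_k) ->
  (p * q)@_m = (p' * q')@_m.
Proof.
move=> eqp eqq; rewrite !mcoeffM; apply: eq_bigr => k _.
by rewrite eqp ?eqq // -ltnS bmdeg.
Qed.

Lemma fcoef_mul d f g m : (mdeg m < d)%N ->
  fcoef (fps_mul f g) m = (fps_trunc d f * fps_trunc d g)@_m.
Proof.
move=> ltmd; rewrite mcoeffM /=; apply: eq_bigr => k _.
by rewrite !mcoeff_trunc //; apply: leq_trans ltmd; rewrite bmdeg.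
Qed.

Lemma fps_mulA : associative fps_mul.
Proof.
move=> f g h; apply: fpsP => m.
rewrite !(@fcoef_mul (mdeg m).+1) //.
transitivity ((fps_trunc (mdeg m).+1 f *
  (fps_trunc (mdeg m).+1 g * fps_trunc (mdeg m).+1 h))@_m).
  apply: mcoeffM_eq => // k lek.
  by rewrite mcoeff_trunc // (@fcoef_mul (mdeg m).+1).
rewrite mulrA; apply: mcoeffM_eq => // k lek.
by rewrite mcoeff_trunc // (@fcoef_mul (mdeg m).+1).
Qed.

Lemma fps_mulC : commutative fps_mul.
Proof.
by move=> f g; apply: fpsP => m; rewrite !(@fcoef_mul (mdeg m).+1) // mulrC.
Qed.

Lemma fps_mul1 : left_id fps_one fps_mul.
Proof.
move=> f; apply: fpsP => m; rewrite (@fcoef_mul (mdeg m).+1) //.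
rewrite -[RHS](@mcoeff_trunc (mdeg m).+1) // -[in RHS](mul1r (fps_trunc _ _)).
by apply: mcoeffM_eq => // k lek; rewrite mcoeff_trunc // mcoeff1.
Qed.

Lemma fps_mulD : left_distributive fps_mul fps_add.
Proof.
move=> f g h; apply: fpsP => m /=; rewrite -big_split /=.
by apply: eq_bigr => k _; rewrite mulrDl.
Qed.

Lemma fps_oner_neq0 : fps_one != 0.
Proof.
apply/eqP => /(congr1 (fun f => fcoef f 0%MM)) /= /eqP.
by rewrite eqxx oner_eq0.
Qed.

HB.instance Definition _ := GRing.Zmodule_isComNzRing.Build {fps K[N]}
  fps_mulA fps_mulC fps_mul1 fps_mulD fps_oner_neq0.

Definition fpsT (i : 'I_N) : {fps K[N]} := MFps (fun m => (m == U_(i)%MM)%:R).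

End FpsRing.

Section Ideals.
Variable A : comNzRingType.
Local Open Scope classical_set_scope.

Definition ideal_gen (S : set A) : set A :=
  [set x | exists (r : nat) (a s : 'I_r -> A),
     (forall j, S (s j)) /\ x = \sum_(j < r) a j * s j].

Definition ideal_mul (I J : set A) : set A :=
  ideal_gen [set x | exists a b, [/\ I a, J b & x = a * b]].

Definition ideal_pow (I : set A) (k : nat) : set A :=
  iter k (ideal_mul I) setT.

End Ideals.

Definition fps_max (N : nat) (K : comNzRingType) : set {fps K[N]} :=
  ideal_gen (range (@fpsT N K)).

Section ArtinFunction.
Variables (N : nat) (K : fieldType) (n r : nat).
Variable f : 'I_r -> {mpoly {fps K[N]}[n]}.

Definition artin_bound (beta : nat -> nat) : Prop :=
  forall (i : nat) (x : 'I_n -> {fps K[N]}),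
    (forall l, ideal_pow (@fps_max N K) (beta i).+1 ((f l).@[x])) ->
    exists y : 'I_n -> {fps K[N]},
      (forall l, (f l).@[y] = 0) /\
      (forall j, ideal_pow (@fps_max N K) i.+1 (y j - x j)).

(* This depends only on the ideal generated by the family [f].  A bound at one
   index [i] does not constrain the others, so the pointwise minimum of all
   bounds is itself a bound, and it exists as soon as some bound does. *)
Definition is_artin_function (beta : nat -> nat) : Prop :=
  artin_bound beta /\
  forall beta', artin_bound beta' -> forall i, (beta i <= beta' i)%N.

End ArtinFunction.

(* The principal ideal (P), with the one-element generating family. *)
Definition is_artin_function_poly (N : nat) (K : fieldType) (n : nat)
    (P : {mpoly {fps K[N]}[n]}) (beta : nat -> nat) : Prop :=
  is_artin_function (fun _ : 'I_1 => P) beta.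

Definition whitney (N : nat) (K : fieldType) : {mpoly {fps K[N]}[3]} :=
  let X := 'X_(@Ordinal 3 0 isT) in
  let Y := 'X_(@Ordinal 3 1 isT) in
  let Z := 'X_(@Ordinal 3 2 isT) in
  X ^+ 2 - Z * Y ^+ 2.

(* Main.v *)
Require Import Defs.
From mathcomp Require Import all_boot all_order all_algebra.
From mathcomp Require Import boolp classical_sets reals.
From mathcomp Require Import mpoly.
From mathcomp Require Import zify ring lra.

Set Implicit Arguments.
Unset Strict Implicit.
Unset Printing Implicit Defensive.

Import Order.TTheory GRing.Theory Num.Theory.
Local Open Scope ring_scope.

(** Fix an odd [m] and put [z = T_0^2 + T_1^m].  Expanding
    [(T_0 + sqrt z)^n = x + y sqrt z] gives, by multiplicativity of the norm,
    [x^2 - z y^2 = (T_0^2 - z)^n = (- T_1^m)^n], of order [m n], while [y] is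
    congruent to [2^(n-1) T_0^(n-1)] modulo [T_1], hence of order at most
    [n - 1].  On the other hand, an exact zero [(X, Y, Z)] with [Z] congruent
    to [z] modulo degree [m + 1] has [Y = 0]: for the monomial valuation giving
    [T_0] the weight [m + 1] and the other variables the weight [1], the value
    of [Z] is the odd number [m], whereas [X^2 = Z Y^2].  Taking [n = i + 1]
    and [m = i] or [i - 1], no zero is congruent to [(x, y, z)] modulo degree
    [i + 1], so [beta i >= m n >= i^2 - 1]. *)

(** * Coefficients of products and powers of the maximal ideal *)

(** The condition bears on supports only, so that it serves both powers of a variable and products
    of least monomials. *)
Lemma fcoefM_single (N : nat) (K : comNzRingType) (f g : {fps K[N]})
    (a b : 'X_{1..N}) :
  (forall k l, fcoef f k != 0 -> fcoef g l != 0 -> (k + l)%MM = (a + b)%MM ->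
     k = a) ->
  fcoef (f * g) (a + b)%MM = fcoef f a * fcoef g b.
Proof.
move=> fg_ab; set d := (mdeg (a + b)%MM).+1.
have lta : (mdeg a < d)%N by rewrite /d ltnS mdegD leq_addr.
have ltb : (mdeg b < d)%N by rewrite /d ltnS mdegD leq_addl.
transitivity (\sum_(k : 'X_{1..N < d, d} | (a + b)%MM == (k.1 + k.2)%MM)
  fcoef f k.1 * fcoef g k.2) => //.
rewrite (bigD1 (BMultinom lta, BMultinom ltb)) //= big1 ?addr0 //.
move=> [k l] /andP[/eqP/= ab_kl neq].
have [->|fk] := eqVneq (fcoef f k) 0; first by rewrite mul0r.
have [->|gl] := eqVneq (fcoef g l) 0; first by rewrite mulr0.
have ka := fg_ab _ _ fk gl (esym ab_kl).
case/eqP: neq; congr (_, _); apply: val_inj => //=.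
by apply: (@addmI _ a); rewrite ab_kl ka.
Qed.

Lemma fcoefM_neq0 (N : nat) (K : comNzRingType) (f g : {fps K[N]})
    (m : 'X_{1..N}) :
  fcoef (f * g) m != 0 ->
  exists k l, [/\ fcoef f k != 0, fcoef g l != 0 & m = (k + l)%MM].
Proof.
move=> fgm; apply: contrapT => nkl; case/eqP: fgm.
transitivity (\sum_(k : 'X_{1..N < (mdeg m).+1, (mdeg m).+1} |
  m == (k.1 + k.2)%MM) fcoef f k.1 * fcoef g k.2) => //.
apply: big1 => -[k l] /= /eqP mkl.
have [->|fk] := eqVneq (fcoef f k) 0; first by rewrite mul0r.
have [->|gl] := eqVneq (fcoef g l) 0; first by rewrite mulr0.
by case: nkl; exists (bmnm k), (bmnm l).
Qed.

Lemma fcoef_sum (N : nat) (K : comNzRingType) (I : Type) (s : seq I)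
    (F : I -> {fps K[N]}) (m : 'X_{1..N}) :
  fcoef (\sum_(i <- s) F i) m = \sum_(i <- s) fcoef (F i) m.
Proof. by apply: (big_morph (fun f => fcoef f m)). Qed.

Lemma fcoef_fpsTX (N : nat) (K : comNzRingType) (i : 'I_N) (n : nat)
    (m : 'X_{1..N}) :
  fcoef (fpsT K i ^+ n) m = (m == (U_(i) *+ n)%MM)%:R.
Proof.
elim: n m => [|n IHn] m; first by rewrite expr0 mulm0n.
rewrite exprS; have [->|mn] := eqVneq m _.
  rewrite mulmS fcoefM_single; first by rewrite IHn /= !eqxx mulr1.
  by move=> k l /=; case: (k =P _) => //; rewrite eqxx.
apply/eqP/negP => /negP/fcoefM_neq0[k [l [/=]]].
case: (k =P _) => [->|]; last by rewrite eqxx.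
rewrite IHn; case: (l =P _) => [->|]; last by rewrite eqxx.
by rewrite -mulmS => _ _ mE; rewrite mE eqxx in mn.
Qed.

Lemma fcoef_fpsTM_eq0 (N : nat) (K : comNzRingType) (i : 'I_N)
    (g : {fps K[N]}) (m : 'X_{1..N}) :
  m i = 0%N -> fcoef (fpsT K i * g) m = 0.
Proof.
move=> mi0; apply/eqP/negP => /negP/fcoefM_neq0[k [l [/=]]].
case: (k =P _) => [-> _ _ mE|]; last by rewrite eqxx.
by move: mi0; rewrite mE mnmDE mnm1E eqxx.
Qed.

(** The maximal ideal is generated by variables, so each factor from it raises the degree of every
    monomial by at least one. *)
Lemma fcoef_ideal_pow (N : nat) (K : comNzRingType) (k : nat) (f : {fps K[N]})
    (m : 'X_{1..N}) :
  ideal_pow (@fps_max N K) k f -> (mdeg m < k)%N -> fcoef f m = 0.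
Proof.
elim: k f m => // k IHk f m [r [a [s [sP ->]]]] ltmk.
rewrite fcoef_sum big1 // => j _; apply/eqP/negP => /negP/fcoefM_neq0.
move=> [k1 [k2 [_ + mE]]].
have [u [v [[r' [a' [s' [s'P ->]]]] vI ->]]] := sP j.
move=> /fcoefM_neq0[l1 [l2 [+ vl2 k2E]]].
rewrite fcoef_sum => /eqP; apply.
rewrite big1 // => j' _; apply/eqP/negP => /negP/fcoefM_neq0.
move=> [n1 [n2 [_ + l1E]]]; have [i _ <-] := s'P j'.
rewrite /=; case: (n2 =P _) => [n2E|]; last by rewrite eqxx.
move=> _; move/eqP: vl2; apply; apply: IHk => //.
move: ltmk; rewrite mE k2E l1E n2E !mdegD mdeg1; lia.
Qed.

Lemma ideal_gen_mull (A : comNzRingType) (S : set A) (a x : A) :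
  S x -> ideal_gen S (a * x).
Proof.
by move=> Sx; exists 1%N, (fun=> a), (fun=> x); rewrite big_ord1.
Qed.

Lemma ideal_pow_exprM (A : comNzRingType) (I : set A) (t g : A) (n k : nat) :
  I t -> (n <= k)%N -> ideal_pow I n (t ^+ k * g).
Proof.
move=> It; elim: n k => // n IHn [//|k] lenk.
rewrite exprS -mulrA -[X in ideal_pow _ _ X]mul1r.
by apply: ideal_gen_mull; exists t, (t ^+ k * g); split=> //; apply: IHn.
Qed.

(** * Powers of [t] plus a square root of [z] *)

(** The coordinates of [(t + sqrt z)^n] on [1] and [sqrt z], obtained without adjoining the root. *)
Fixpoint pell (A : comNzRingType) (t z : A) (n : nat) : A * A :=
  if n is n'.+1 then
    let p := pell t z n' in (t * p.1 + z * p.2, p.1 + t * p.2)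
  else (1, 0).

Lemma pell_norm (A : comNzRingType) (t z : A) (n : nat) :
  (pell t z n).1 ^+ 2 - z * (pell t z n).2 ^+ 2 = (t ^+ 2 - z) ^+ n.
Proof.
elim: n => [|n IHn] /=; first by rewrite expr0; ring.
by rewrite [RHS]exprS -IHn; ring.
Qed.

(** Modulo [s], [z] is [t^2], hence [(t + sqrt z)^2 = 2 t (t + sqrt z)] and [(t + sqrt z)^(n+1) = (2
    t)^n (t + sqrt z)]. *)
Lemma pell_mod (A : comNzRingType) (t s w : A) (n : nat) :
  exists g h, pell t (t ^+ 2 + s * w) n.+1 =
    ((2 ^ n)%:R * t ^+ n.+1 + s * g, (2 ^ n)%:R * t ^+ n + s * h).
Proof.
elim: n => [|n [g [h IHn]]].
  by exists 0, 0; rewrite /= expn0; congr (_, _); ring.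
exists (t * g + w * ((2 ^ n)%:R * t ^+ n) + (t ^+ 2 + s * w) * h), (g + t * h).
set z := t ^+ 2 + s * w in IHn *.
rewrite -[pell t z n.+2]/(t * (pell t z n.+1).1 + z * (pell t z n.+1).2,
  (pell t z n.+1).1 + t * (pell t z n.+1).2) IHn /= /z expnS natrM !exprS.
by congr (_, _); ring.
Qed.

(** * Weighted valuations of power series *)

(** A relation rather than a function, since the zero series has no value. *)
Definition fps_value (N : nat) (K : comNzRingType) (w : 'X_{1..N} -> nat)
    (f : {fps K[N]}) (d : nat) : Prop :=
  (exists2 k, fcoef f k != 0 & w k = d) /\
  forall k, fcoef f k != 0 -> (d <= w k)%N.

Lemma fps_value_inj (N : nat) (K : comNzRingType) (w : 'X_{1..N} -> nat)
    (f : {fps K[N]}) (d e : nat) :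
  fps_value w f d -> fps_value w f e -> d = e.
Proof.
move=> [[k fk <-] kP] [[l fl <-] lP].
by apply/eqP; rewrite eqn_leq kP // lP.
Qed.

Lemma fps_value_exists (N : nat) (K : comNzRingType) (w : 'X_{1..N} -> nat)
    (f : {fps K[N]}) :
  f != 0 -> exists d, fps_value w f d.
Proof.
move=> f0; have [k0 fk0] : exists k, fcoef f k != 0.
  apply: contrapT => nk; case/eqP: f0; apply: fpsP => k /=.
  by apply/eqP/negP => /negP fk; apply: nk; exists k.
have exd : exists d, `[< exists2 k, fcoef f k != 0 & w k = d >].
  by exists (w k0); apply/asboolP; exists k0.
case: (ex_minnP exd) => d /asboolP dP dmin; exists d; split=> // k fk.
by apply: dmin; apply/asboolP; exists k.
Qed.

(** Descent along the monomial order, which is well founded; the monomials of weight [d] may be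
    infinite in number. *)
Lemma fps_value_least (N : nat) (K : comNzRingType) (w : 'X_{1..N} -> nat)
    (f : {fps K[N]}) (d : nat) :
  fps_value w f d -> exists a, [/\ fcoef f a != 0, w a = d &
    forall k, fcoef f k != 0 -> w k = d -> (a <= k)%O].
Proof.
move=> [[k fk wk] _]; elim/(well_founded_ind (@ltom_wf N)): k fk wk => k IHk fk wk.
have [[l [fl wl ltlk]]|nol] :=
  pselect (exists l, [/\ fcoef f l != 0, w l = d & (l < k)%O]).
  exact: IHk ltlk fl wl.
exists k; split=> // l fl wl; rewrite leNgt; apply/negP => ltlk.
by apply: nol; exists l.
Qed.

(* The monomial order breaks ties between monomials of equal weight, so that
   no cancellation can occur in the coefficient of the least monomial. *)
Lemma fps_valueM (N : nat) (K : idomainType) (w : 'X_{1..N} -> nat)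
    (f g : {fps K[N]}) (d e : nat) :
  {morph w : k l / (k + l)%MM >-> (k + l)%N} ->
  fps_value w f d -> fps_value w g e -> fps_value w (f * g) (d + e)%N.
Proof.
move=> wD fd ge; have [a [fa wa aP]] := fps_value_least fd.
have [b [gb wb bP]] := fps_value_least ge.
have [[_ fdP] [_ geP]] := (fd, ge); split; last first.
  move=> m /fcoefM_neq0[k [l [fk gl ->]]].
  by rewrite wD leq_add ?fdP ?geP.
exists (a + b)%MM; last by rewrite wD wa wb.
rewrite fcoefM_single ?mulf_neq0 // => k l fk gl klE.
have := congr1 w klE; rewrite !wD wa wb => wkl.
have [dk el] := (fdP _ fk, geP _ gl).
have leak : (a <= k)%O by apply: aP => //; lia.
have lebl : (b <= l)%O by apply: bP => //; lia.
apply/eqP; rewrite eq_le leak andbT leNgt; apply/negP => ltak.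
have := ltmc_le_add ltak lebl.
by rewrite klE ltxx.
Qed.

(** If [y] were nonzero, [z * y ^+ 2] would have an odd value and [x ^+ 2] an even one. *)
Lemma odd_value_not_square (N : nat) (K : idomainType) (w : 'X_{1..N} -> nat)
    (x y z : {fps K[N]}) (d : nat) :
  {morph w : k l / (k + l)%MM >-> (k + l)%N} ->
  fps_value w z d -> odd d -> x ^+ 2 = z * y ^+ 2 -> y = 0.
Proof.
move=> wD zd odd_d xzy; apply/eqP/negP => /negP y0.
have [e ye] := fps_value_exists w y0.
have zye := fps_valueM wD zd (fps_valueM wD ye ye).
have x0 : x != 0.
  apply/eqP => x0; have [[k + _] _] := zye.
  by rewrite -expr2 -xzy x0 expr0n /= eqxx.
have [c xc] := fps_value_exists w x0.
have := fps_valueM wD xc xc; rewrite -expr2 xzy expr2.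
move=> /(fps_value_inj zye); lia.
Qed.

(** The weight is at least the degree, so a monomial of weight below [m] lies where [z] is known.
    There only two monomials occur: the square of the variable [i0], of weight [2 (m + 1)], and the
    [m]-th power of the variable [i1], of weight [m]. *)
Lemma fps_value_perturb (N : nat) (K : comNzRingType) (i0 i1 : 'I_N) (m : nat)
    (z : {fps K[N]}) :
  i0 != i1 -> (0 < m)%N ->
  (forall k, (mdeg k <= m)%N ->
     fcoef z k = fcoef (fpsT K i0 ^+ 2 + fpsT K i1 ^+ m) k) ->
  fps_value (fun k : 'X_{1..N} => mdeg k + m * k i0)%N z m.
Proof.
move=> i01 m0 zz.
have zE k : (mdeg k <= m)%N ->
    fcoef z k = (k == (U_(i0) *+ 2)%MM)%:R + (k == (U_(i1) *+ m)%MM)%:R.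
  by move=> /zz ->; rewrite -!fcoef_fpsTX.
have wi1 : (U_(i1) *+ m)%MM i0 = 0%N by rewrite mulmnE mnm1E eq_sym (negPf i01).
split.
  exists (U_(i1) *+ m)%MM; last by rewrite wi1 mdegMn mdeg1; lia.
  rewrite zE ?mdegMn ?mdeg1 ?mul1n // eqxx [(_ *+ m)%MM == _]negbTE ?add0r ?oner_eq0 //.
  by apply/eqP => mE; move: wi1; rewrite mE mulmnE mnm1E eqxx.
move=> k zk; rewrite leqNgt; apply/negP => ltk; case/eqP: zk.
rewrite zE; last lia.
have [kE|_] := eqVneq k _.
  by move: ltk; rewrite kE mdegMn mulmnE mnm1E eqxx; lia.
have [kE|_] := eqVneq k _; last by rewrite addr0.
by move: ltk; rewrite kE mdegMn mdeg1; lia.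
Qed.

(** * The lower bound on the Artin function *)

Lemma whitneyE (N : nat) (K : fieldType) (v : 'I_3 -> {fps K[N]}) :
  (whitney N K).@[v] =
  v (@Ordinal 3 0 isT) ^+ 2 - v (@Ordinal 3 2 isT) * v (@Ordinal 3 1 isT) ^+ 2.
Proof. by rewrite /whitney !expr2 mevalB !mevalM !mevalXU. Qed.

Lemma fcoef_natM (N : nat) (K : comNzRingType) (n : nat) (f : {fps K[N]})
    (m : 'X_{1..N}) :
  fcoef (n%:R * f) m = n%:R * fcoef f m.
Proof.
rewrite !mulr_natl; elim: n => [|n IHn]; first by rewrite !mulr0n.
by rewrite !mulrS -IHn.
Qed.

Lemma whitney_artin_bound_ge (N : nat) (K : fieldType) (beta : nat -> nat)
    (i0 i1 : 'I_N) (i m : nat) :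
  i0 != i1 -> 2%N \notin [pchar K] ->
  artin_bound (fun _ : 'I_1 => whitney N K) beta ->
  odd m -> (m <= i)%N -> (m * i.+1 <= beta i)%N.
Proof.
move=> i01 char2 betaP odd_m lemi; have m0 : (0 < m)%N by case: m odd_m lemi.
rewrite leqNgt; apply/negP => ltb.
pose t := fpsT K i0; pose s := fpsT K i1.
pose z := t ^+ 2 + s ^+ m; pose p := pell t z i.+1.
pose v (j : 'I_3) := tnth [tuple p.1; p.2; z] j.
have v0 : v (@Ordinal 3 0 isT) = p.1 by [].
have v1 : v (@Ordinal 3 1 isT) = p.2 by [].
have v2 : v (@Ordinal 3 2 isT) = z by [].
case: (betaP i v).
  (* The polynomial takes the value [(- s ^+ m) ^+ i.+1] at [v], and [ltb] places it in the required
     power of the ideal. *)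
  move=> _; rewrite whitneyE v0 v1 v2 pell_norm.
  have -> : t ^+ 2 - z = - 1 * s ^+ m by rewrite /z; ring.
  rewrite exprMn -exprM mulrC; apply: ideal_pow_exprM => //.
  by rewrite -[s]mul1r; apply: ideal_gen_mull; exists i1.
move=> y [/(_ ord0)]; rewrite whitneyE => /eqP; rewrite subr_eq0 => /eqP yP yv.
(* As [m <= i], the third coordinate of [y] agrees with [z] up to degree [m], so its value is still
   [m]. *)
have y1 : y (@Ordinal 3 1 isT) = 0.
  apply: (odd_value_not_square _ (fps_value_perturb i01 m0 _) odd_m yP).
    by move=> k l; rewrite mdegD mnmDE; lia.
  move=> k lekm; apply/eqP; rewrite -subr_eq0; apply/eqP.
  have := yv (@Ordinal 3 2 isT); rewrite v2.
  by move=> /(@fcoef_ideal_pow _ _ _ _ k); apply; rewrite ltnS (leq_trans lekm).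
have := yv (@Ordinal 3 1 isT); rewrite y1 sub0r v1 /p.
have [g [h pE]] := pell_mod t s (s ^+ m.-1) i.
(* This monomial has degree [i], just within the range of agreement. Its coefficient in [p.2] is
   [2 ^ i], because every monomial of [s * h] involves the variable [i1]. *)
move=> /(@fcoef_ideal_pow _ _ _ _ (U_(i0) *+ i)%MM).
rewrite mdegMn mdeg1 mul1n ltnSn => /(_ isT) /eqP.
have -> : z = t ^+ 2 + s * s ^+ m.-1 by rewrite -exprS prednK.
rewrite pE [fcoef _ _]/(- (fcoef (_ * _) _ + fcoef (s * h) _)) oppr_eq0.
rewrite [fcoef (s * h) _]fcoef_fpsTM_eq0; last first.
  by rewrite mulmnE mnm1E (negPf i01).
rewrite addr0 fcoef_natM fcoef_fpsTX eqxx mulr1 natrX expf_eq0.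
by move: char2; rewrite inE /= => /negPf ->; rewrite andbF.
Qed.

Theorem mainTheorem1 (R : realType) (N : nat) (K : fieldType)
    (beta : nat -> nat) :
  (2 <= N)%N ->
  2%N \notin [pchar K] ->
  is_artin_function_poly (whitney N K) beta ->
  exists q : {poly R},
    [/\ size q = 3%N, 0 < lead_coef q &
        forall i : nat, q.[i%:R] <= (beta i)%:R].
Proof.
move=> N2 char2 [betaP _].
have q3 : size ('X^2 - 1 : {poly R}) = 3%N by rewrite size_XnsubC.
(* The largest odd [m <= i] is at least [i - 1], and [(i - 1)(i + 1) = i^2 - 1]. For [i = 0] there
   is no such [m], but the polynomial is negative there. *)
exists ('X^2 - 1); split=> // [|i].
  by rewrite (monicP (monicXnsubC 1 _)).
have [->|i0] := posnP i; first by apply: le_trans (ler0n _ _); rewrite !hornerE expr0n /=; lra.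
have i01 : Ordinal (ltnW N2) != Ordinal N2 by [].
have [m [odd_m lemi leim]] : exists m, [/\ odd m, (m <= i)%N & (i <= m.+1)%N].
  have [oi|ei] := boolP (odd i); first by exists i; split=> //; lia.
  by exists i.-1; split; lia.
have := whitney_artin_bound_ge i01 char2 betaP odd_m lemi.
rewrite !hornerE lerBlDr -natrX natr1 ler_nat; nia.
Qed.
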